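(* Let $d,d_0\in\mathbb{N}$, let $a=(a_{ij})_{1\le i<j\le d_0}$ with $a_{ij}\ne0$ for all $j>i$, and let $\mathcal{H}_{\mathrm{FM}}(\bullet;a):\mathbb{R}^{d\times d_0}\to\mathbb{R}^{(d_0-1)d_0/2}$, $\mathcal{H}_{\mathrm{FM}}(P;a):=(a_{ij}\,p_i^{\mathrm T}p_j)_{1\le i<j\le d_0}$, where $p_1,\dots,p_{d_0}$ are the columns of $P$. Then $\mathcal{H}_{\mathrm{FM}}(\bullet;a)$ is locally surjective at the origin if and only if $d\ge d_0-1$.
   Context: $\mathbb{N}$ is the set of positive integers. Matrix spaces carry the Frobenius norm, vector spaces the Euclidean norm, and $\mathbb{B}$ denotes the closed unit ball of the relevant space. Entries indexed by pairs $i<j$ are ordered lexicographically. A mapping $\mathcal{F}$ between Euclidean spaces is locally surjective at $x$ if for any $t>0$ there exists $r>0$ such that $\mathcal{F}(x)+r\mathbb{B}\subseteq\mathcal{F}(x+t\mathbb{B})$. *)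

(* Defs.v *)
From mathcomp Require Export all_boot all_order all_algebra.
From mathcomp Require Export classical_sets reals.

Set Implicit Arguments.
Unset Strict Implicit.
Unset Printing Implicit Defensive.

Import Order.TTheory GRing.Theory Num.Theory.

Local Open Scope classical_set_scope.
Local Open Scope ring_scope.

(* The norm that MathComp-Analysis puts on matrices is the max norm, hence a
   separate definition. Vectors are one-column matrices, and on them this is
   the Euclidean norm. *)
Definition frobenius_norm (R : realType) m n (M : 'M[R]_(m, n)) : R :=
  Num.sqrt (\sum_(i < m) \sum_(j < n) M i j ^+ 2).

Definition closed_unit_ball (R : realType) m n : set 'M[R]_(m, n) :=
  [set M | frobenius_norm M <= 1].
Arguments closed_unit_ball R m n : clear implicits.

Definition ball_around (R : realType) m n (x : 'M[R]_(m, n)) (t : R) :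
    set 'M[R]_(m, n) :=
  [set x + t *: b | b in closed_unit_ball R m n].

Definition locally_surjective (R : realType) m n p q
    (F : 'M[R]_(m, n) -> 'M[R]_(p, q)) (x : 'M[R]_(m, n)) : Prop :=
  forall t : R, 0 < t ->
    exists2 r : R, 0 < r & ball_around (F x) r `<=` F @` ball_around x t.

Definition lt_pairs_seq n : seq ('I_n * 'I_n) :=
  [seq (i, j) | i : 'I_n <- enum 'I_n,
                j : 'I_n <- [seq j : 'I_n <- enum 'I_n | (i < j)%N]].

Lemma size_lt_pairs n : size (lt_pairs_seq n) == (n.-1 * n)./2.
Proof.
rewrite size_allpairs_dep sumnE big_map big_enum /= mulnC -bin2 -bin2_sum.
rewrite big_mkord.
under eq_bigr => i _ do
  rewrite size_filter -sum1_count big_mkcond big_enum /=.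
rewrite exchange_big /=; apply/eqP/eq_bigr => j _.
rewrite -big_mkcond /= sum1_card -[RHS]card_ord.
have widen_inj : injective (widen_ord (ltnW (ltn_ord j))).
  by move=> k l /(congr1 val) /= /val_inj.
rewrite -(card_image widen_inj).
apply: eq_card => i; rewrite unfold_in /=.
apply/idP/mapP => [lt_ij|[k _ ->]]; last exact: (ltn_ord k).
exists (Ordinal (lt_ij : (i < j)%N)); first by rewrite mem_enum.
exact: val_inj.
Qed.

Definition lt_pairs n : ((n.-1 * n)./2).-tuple ('I_n * 'I_n) :=
  Tuple (size_lt_pairs n).

(* Only the entries a i j with i < j are used. *)
Definition H_FM (R : realType) d d0 (a : 'I_d0 -> 'I_d0 -> R)
    (P : 'M[R]_(d, d0)) : 'cV[R]_((d0.-1 * d0)./2) :=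
  \col_k (let: (i, j) := tnth (lt_pairs d0) k in
          a i j * ((col i P)^T *m col j P) 0 0).

(* Main.v *)
Require Import Defs.
From mathcomp Require Import ring lra.

Set Implicit Arguments.
Unset Strict Implicit.
Unset Printing Implicit Defensive.

Import Order.TTheory GRing.Theory Num.Theory.
Local Open Scope ring_scope.

(**
Sufficiency: a triangular Cholesky-type choice [P = (x_lj)] with diagonal [s]
and zeros below it turns [p_k^T p_j = z_kj] (k < j) into
[s x_kj = z_kj - \sum_(l < k) x_lk x_lj], which is solved row after row; the
last column needs no diagonal entry, so [d0 - 1] rows are enough.
If [|z_kj| <= s^2 / 4d], then [|x_kj| <= s / 2d] propagates along the recursion.

Necessity: a point of the image near the origin with [p_i^T p_j = - e] for all
[i < j] would make [P^T P + e J] (J the all-ones matrix) diagonal with positive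
entries, so [d0 <= rank (P^T P) + rank J <= d + 1].
*)

Section FrobeniusNorm.
Variables (R : realType) (m n : nat).
Implicit Types (M : 'M[R]_(m, n)) (c s t : R).

Lemma sum_sqr_ge0 M : 0 <= \sum_(i < m) \sum_(j < n) M i j ^+ 2.
Proof. by apply: sumr_ge0 => i _; apply: sumr_ge0 => j _; rewrite sqr_ge0. Qed.

Lemma frobenius_norm_ge0 M : 0 <= frobenius_norm M.
Proof. exact: sqrtr_ge0. Qed.

Lemma frobenius_normZ c M :
  frobenius_norm (c *: M) = `|c| * frobenius_norm M.
Proof.
rewrite /frobenius_norm -sqrtr_sqr -sqrtrM ?sqr_ge0 // mulr_sumr.
congr Num.sqrt; apply: eq_bigr => i _; rewrite mulr_sumr.
by apply: eq_bigr => j _; rewrite mxE exprMn.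
Qed.

Lemma ler_norm_frobenius M i j : `|M i j| <= frobenius_norm M.
Proof.
rewrite -sqrtr_sqr ler_sqrt ?sum_sqr_ge0 //.
rewrite (bigD1 i) //= (bigD1 j) //= -addrA lerDl addr_ge0 //.
  by apply: sumr_ge0 => k _; rewrite sqr_ge0.
by apply: sumr_ge0 => k _; apply: sumr_ge0 => l _; rewrite sqr_ge0.
Qed.

(** The factor [m * n] is cruder than its square root, but suffices for choosing an entry bound that
    keeps a matrix in a given ball. *)
Lemma frobenius_norm_le M s : (forall i j, `|M i j| <= s) -> 0 <= s ->
  frobenius_norm M <= (m * n)%:R * s.
Proof.
move=> Ms s0; have mns0 : 0 <= (m * n)%:R * s by rewrite mulr_ge0.
rewrite -[leRHS](ger0_norm mns0) -sqrtr_sqr ler_sqrt ?sqr_ge0 //.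
have -> : ((m * n)%:R * s) ^+ 2 = s ^+ 2 *+ ((m * n) ^ 2).
  by rewrite exprMn -natrX mulr_natl.
apply: (@le_trans _ _ (s ^+ 2 *+ (m * n))); last first.
  by rewrite ler_wpMn2l ?sqr_ge0 // -mulnn; case: (m * n)%N => // k; rewrite leq_pmulr.
apply: (@le_trans _ _ (\sum_(i < m) \sum_(j < n) s ^+ 2)).
  apply: ler_sum => i _; apply: ler_sum => j _.
  by rewrite -[M i j ^+ 2]real_normK ?num_real // lerXn2r ?nnegrE.
by rewrite !sumr_const !card_ord -mulrnA mulnC.
Qed.

Lemma ball_around0P t M : 0 < t ->
  ball_around 0 t M <-> frobenius_norm M <= t.
Proof.
move=> t0; split=> [[b b1 <-]|Mt].
  by rewrite add0r frobenius_normZ gtr0_norm // ler_piMr // ltW.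
exists (t^-1 *: M); last by rewrite add0r scalerA divff ?gt_eqF // scale1r.
rewrite /closed_unit_ball /= frobenius_normZ gtr0_norm ?invr_gt0 //.
by rewrite mulrC ler_pdivrMr // mul1r.
Qed.

End FrobeniusNorm.

Lemma mem_lt_pairs n (i j : 'I_n) : ((i, j) \in lt_pairs n) = (i < j)%N.
Proof.
apply/allpairsPdep/idP => [[k [l [_ + [-> ->]]]]|ij].
  by rewrite mem_filter => /andP[].
by exists i, j; split; rewrite ?mem_enum // mem_filter ij mem_enum.
Qed.

Lemma lt_pairs_uniq n : uniq (lt_pairs n).
Proof.
apply: allpairs_uniq_dep => [|i _|[i j] [k l] _ _ [-> ->]] //.
  exact: enum_uniq.
by rewrite filter_uniq // enum_uniq.
Qed.

(** Spreads a vector over the pairs, with 0 where no pair is enumerated, so that a bound on all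
    [|y k|] passes to all [|z i j|]. *)
Lemma lt_pairs_choice n (R : nmodType) (y : 'I_((n.-1 * n)./2) -> R) :
  exists z : 'I_n -> 'I_n -> R,
    (forall k, z (tnth (lt_pairs n) k).1 (tnth (lt_pairs n) k).2 = y k) /\
    (forall i j, z i j = 0 \/ exists k, z i j = y k).
Proof.
exists (fun i j => if [pick k | tnth (lt_pairs n) k == (i, j)] is Some k
                   then y k else 0).
split=> [k|i j]; last by case: pickP => [k _|_]; [right; exists k | left].
case: pickP => [l|/(_ k)]; rewrite -surjective_pairing ?eqxx //.
by move=> /eqP /(tuple_uniqP _ (lt_pairs_uniq n)) ->.
Qed.

Lemma H_FM_E (R : realType) d n (a : 'I_n -> 'I_n -> R) (P : 'M[R]_(d, n)) k :
  let i := (tnth (lt_pairs n) k).1 in let j := (tnth (lt_pairs n) k).2 in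
  H_FM a P k 0 = a i j * (P^T *m P) i j.
Proof.
rewrite mxE /=; case: (tnth _ k) => i j /=; rewrite !mxE; congr (_ * _).
by apply: eq_bigr => l _; rewrite !mxE.
Qed.

Lemma H_FM0 (R : realType) d n (a : 'I_n -> 'I_n -> R) :
  H_FM a (0 : 'M[R]_(d, n)) = 0.
Proof.
by apply/matrixP => k l; rewrite ord1 H_FM_E mulmx0 !mxE mulr0.
Qed.

(** Induction on the number [m] of rows built, with [d] fixed so that the bounds do not worsen. The
    bound [s / (2 * d)] right of the diagonal carries the induction. *)
Lemma triangular_gram_rows (R : realFieldType) d n (s : R)
    (z : 'I_n.+1 -> 'I_n.+1 -> R) m :
  0 < s -> (m <= d)%N ->
  (forall i j, `|z i j| <= s ^+ 2 / (4 * d%:R)) ->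
  exists x : nat -> 'I_n.+1 -> R,
    [/\ forall k (j : 'I_n.+1), (j < k)%N -> x k j = 0,
        forall k (j : 'I_n.+1), (k < j)%N -> `|x k j| <= s / (2 * d%:R),
        forall k (j : 'I_n.+1), `|x k j| <= s
      & forall k j : 'I_n.+1, (k < m)%N -> (k < j)%N ->
          \sum_(l < m) x l k * x l j = z k j].
Proof.
move=> s0 + zs; elim: m => [_|m IHm md].
  exists (fun _ _ => 0); split=> // *; rewrite normr0 ?(ltW s0) //.
  by rewrite divr_ge0 ?mulr_ge0 ?(ltW s0).
have [x [x_lo x_hi x_s xz]] := IHm (ltnW md).
have d1 : 1 <= d%:R :> R by rewrite ler1n (leq_trans _ md).
have d0 : 0 < d%:R :> R by rewrite (lt_le_trans ltr01).
(* If [m > n], [inord] returns a default, but [w] reads column [q] only for some [j > m], and then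
   [q = m]. *)
set q := inord m : 'I_n.+1.
pose w (j : 'I_n.+1) := if (j < m)%N then 0 else if j == m :> nat then s else
  (z q j - \sum_(l < m) x l q * x l j) / s.
have w_hi (j : 'I_n.+1) : (m < j)%N -> `|w j| <= s / (2 * d%:R).
  move=> mj; rewrite /w ltnNge (ltnW mj) /= gtn_eqF // normrM normfV.
  rewrite (gtr0_norm s0) ler_pdivrMr //.
  have qE : q = m :> nat by rewrite inordK // (ltn_trans mj).
  apply: (le_trans (ler_normB _ _)).
  (* Columns [q] and [j] lie right of the diagonal in every earlier row. The sum is thus at most
     [s^2 / (4d)], as is [|z q j|]; together they give [s * (s / (2d))]. *)
  have : `|\sum_(l < m) x l q * x l j| <= d%:R * (s / (2 * d%:R)) ^+ 2.
    apply: (le_trans (ler_norm_sum _ _ _)).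
    apply: (@le_trans _ _ (\sum_(l < m) (s / (2 * d%:R)) ^+ 2)).
      apply: ler_sum => l _; rewrite normrM expr2 ler_pM //; apply: x_hi.
        by rewrite qE.
      exact: ltn_trans mj.
    rewrite sumr_const card_ord -[leLHS]mulr_natl ler_wpM2r ?sqr_ge0 //.
    by rewrite ler_nat ltnW.
  move=> /(lerD (zs q j)) /le_trans; apply.
  rewrite le_eqVlt; apply/orP; left; apply/eqP; field.
  by rewrite gt_eqF.
exists (fun k j => if k == m then w j else x k j); split.
- move=> k j jk; case: eqP => [km|_]; last exact: x_lo.
  by rewrite /w -km jk.
- by move=> k j kj; case: eqP => [km|_]; [apply: w_hi; rewrite -km | apply: x_hi].
- move=> k j; case: eqP => // _; case: (ltngtP j m) => jm.
  + by rewrite /w jm normr0 ltW.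
  + apply: (le_trans (w_hi _ jm)); rewrite ler_pdivrMr ?mulr_gt0 //.
    by rewrite ler_peMr ?ltW //; lra.
  + by rewrite /w jm ltnn eqxx gtr0_norm.
move=> k j km kj; rewrite big_ord_recr /= eqxx.
under eq_bigr => l _ do rewrite (ltn_eqF (ltn_ord l)).
(* For [k < m] the new row vanishes in column [k] and keeps the old equation; for [k = m] its
   diagonal entry [s] cancels the division in [w]. *)
move: km; rewrite ltnS leq_eqVlt => /predU1P[km|km]; last first.
  by rewrite [w k]/w km mul0r addr0 xz.
have -> : k = q by apply: val_inj; rewrite /= inordK -?km.
have qE : q = m :> nat by rewrite inordK -?km.
rewrite /w qE ltnn eqxx -km ltnNge (ltnW kj) /= gtn_eqF //.
by rewrite mulrC divfK ?gt_eqF // addrC subrK.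
Qed.

Lemma triangular_gram (R : realFieldType) d n (s : R)
    (z : 'I_n.+1 -> 'I_n.+1 -> R) :
  0 < s -> (n <= d)%N ->
  (forall i j, `|z i j| <= s ^+ 2 / (4 * d%:R)) ->
  exists P : 'M[R]_(d, n.+1),
    (forall i j, `|P i j| <= s) /\
    (forall i j : 'I_n.+1, (i < j)%N -> (P^T *m P) i j = z i j).
Proof.
move=> s0 nd zs; have [x [_ _ x_s xz]] := triangular_gram_rows s0 (leqnn d) zs.
exists (\matrix_(i, j) x i j); split=> [i j|i j ij]; first by rewrite mxE.
(* The smaller index of a pair is never the last column: [i < j <= n <= d]. *)
rewrite mxE -xz //; last by rewrite (leq_trans ij) // (leq_trans _ nd) // -ltnS.
by apply: eq_bigr => l _; rewrite !mxE.
Qed.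

Lemma equal_negative_products_bound (R : realFieldType) d n (P : 'M[R]_(d, n))
    (e : R) :
  0 < e -> (forall i j : 'I_n, (i < j)%N -> (P^T *m P) i j = - e) ->
  (n - 1 <= d)%N.
Proof.
move=> e0 Pe.
(* Written as a column times a row, so that its rank is visibly at most 1. *)
pose J : 'M[R]_n := const_mx e *m (const_mx 1 : 'rV_n).
have JE i j : J i j = e by rewrite mxE big_ord1 !mxE mulr1.
pose D := \row_j ((P^T *m P) j j + e).
have DE : P^T *m P + J = diag_mx D.
  apply/matrixP => i j; rewrite mxE JE [RHS]mxE [D 0 i]mxE.
  case: (ltngtP i j) => [ij|ij|/val_inj ->]; last by rewrite eqxx.
    by rewrite (Pe _ _ ij) addNr -val_eqE /= ltn_eqF.
  have -> : (P^T *m P) i j = (P^T *m P) j i.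
    by rewrite !mxE; apply: eq_bigr => l _; rewrite !mxE mulrC.
  by rewrite (Pe _ _ ij) addNr -val_eqE /= gtn_eqF.
have Du : diag_mx D \in unitmx.
  rewrite unitmxE det_diag unitfE; apply/prodf_neq0 => j _.
  (* Each diagonal entry is a squared column norm plus [e]. *)
  rewrite !mxE gt_eqF // ltr_wpDl //.
  by apply: sumr_ge0 => k _; rewrite mxE -expr2 sqr_ge0.
rewrite leq_subLR -(mxrank_unit Du) -DE (leq_trans (mxrank_add _ _)) // addnC.
apply: leq_add; first exact: (leq_trans (mxrankM_maxr _ _) (rank_leq_row _)).
exact: (leq_trans (mxrankM_maxr _ _) (rank_leq_row _)).
Qed.

Theorem corollary3p16 (R : realType) (d d0 : nat) (hd : (0 < d)%N)
    (hd0 : (0 < d0)%N) (a : 'I_d0 -> 'I_d0 -> R)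
    (ha : forall i j : 'I_d0, (i < j)%N -> a i j != 0) :
  locally_surjective (@H_FM R d d0 a) 0
  <-> (d0 - 1 <= d)%N.
Proof.
pose A k := a (tnth (lt_pairs d0) k).1 (tnth (lt_pairs d0) k).2.
have A0 k : A k != 0.
  by apply: ha; rewrite -mem_lt_pairs -surjective_pairing mem_tnth.
split=> [surj|].
- have [r r0] := surj 1 ltr01; rewrite H_FM0 => sub.
  (* Hitting [- e *: v] and cancelling the nonzero [a i j] makes all products equal to [- e]. *)
  pose v : 'cV[R]_((d0.-1 * d0)./2) := \col_k A k.
  have N0 : 0 < 1 + frobenius_norm v by rewrite ltr_pwDl // frobenius_norm_ge0.
  (* Ensures [e * |v| <= r]; the added 1 covers [v = 0], as when there are no pairs. *)
  pose e := r / (1 + frobenius_norm v); have e0 : 0 < e by rewrite divr_gt0.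
  have /sub[P _ Pv] : ball_around 0 r (- e *: v).
    apply/ball_around0P => //; rewrite frobenius_normZ normrN gtr0_norm //.
    by rewrite mulrAC ler_pdivrMr // ler_pM2l // lerDr.
  apply: (equal_negative_products_bound (P := P) e0) => i j.
  rewrite -mem_lt_pairs => /tnthP[k kE].
  have := congr1 (fun M : 'cV[R]_((d0.-1 * d0)./2) => M k 0) Pv.
  rewrite H_FM_E [RHS]mxE [v k 0]mxE -/(A k) mulrC => /(mulIf (A0 k)).
  by rewrite -kE.
case: d0 hd0 a ha @A A0 => // n _ a _ A A0; rewrite subn1 /= => nd t t0.
have d_gt0 : 0 < d%:R :> R by rewrite ltr0n.
(* Entries bounded by [s] give Frobenius norm at most [d * n.+1 * s = t]. *)
pose s := t / (d * n.+1)%:R.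
have s0 : 0 < s by rewrite divr_gt0 // ltr0n muln_gt0 hd.
(* [S] is positive and dominates every [|1 / A k|], so [|y k 0| <= r] yields
   [|y k 0 / A k| <= r * S], the bound required of [z]. *)
pose S := 1 + \sum_k `|(A k)^-1|.
have S0 : 0 < S by rewrite ltr_pwDl // sumr_ge0.
have c0 : 0 < s ^+ 2 / (4 * d%:R).
  by rewrite divr_gt0 ?exprn_gt0 // mulr_gt0.
pose r := s ^+ 2 / (4 * d%:R) / S; have r0 : 0 < r by rewrite divr_gt0.
exists r; rewrite // H_FM0 => y /(ball_around0P _ r0) yr.
have [z [zE zv]] := lt_pairs_choice (fun k => y k 0 / A k).
have zs i j : `|z i j| <= s ^+ 2 / (4 * d%:R).
  have [->|[k ->]] := zv i j; first by rewrite normr0 ltW.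
  rewrite normrM -[leRHS](divfK (lt0r_neq0 S0)) ler_pM //.
    exact: le_trans (ler_norm_frobenius _ _ _) yr.
  by rewrite /S (bigD1 k) //= addrCA lerDl addr_ge0 // sumr_ge0.
have [P [Ps PE]] := triangular_gram s0 nd zs.
exists P.
  apply/ball_around0P => //; apply: (le_trans (frobenius_norm_le Ps (ltW s0))).
  by rewrite mulrC divfK // pnatr_eq0 muln_eq0 negb_or -!lt0n hd.
apply/matrixP => k l; rewrite ord1 H_FM_E PE; last first.
  by rewrite -mem_lt_pairs -surjective_pairing mem_tnth.
by rewrite zE mulrC divfK.
Qed.
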